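(* The complete bipartite graphs $K_{r,s}$, for every $r,s\in\mathbb{N}$, are the only graphs to induce a $4$-periodic Grover walk. That is, a finite simple connected graph $G$ induces a $4$-periodic Grover walk if and only if $G$ is a complete bipartite graph $K_{r,s}$ for some $r,s\in\mathbb{N}$.
   Context: Graphs are finite, simple (no loops, no multiple edges) and connected. $\mathbb{N}$ is the set of positive integers, and $K_{r,s}$ denotes the complete bipartite graph with parts of sizes $r$ and $s$. For a graph $G$ with $m=|E(G)|$ edges, let $D(G)$ be the set of symmetric arcs of $G$: each edge $\{u,v\}\in E(G)$ gives the two arcs $(u,v)$ and $(v,u)$, so $|D(G)|=2m$. For an arc $e=(u,v)$ write $o(e)=u$, $t(e)=v$, $e^{-1}=(v,u)$. The Grover transfer matrix of $G$ is the $2m\times 2m$ matrix $U=U(G)=(U_{e,f})_{e,f\in D(G)}$ with $$U_{e,f}=\begin{cases}2/\deg(t(f)) & \text{if } t(f)=o(e) \text{ and } f\neq e^{-1},\\ 2/\deg(t(f))-1 & \text{if } f=e^{-1},\\ 0 & \text{otherwise.}\end{cases}$$ For a positive integer $k$, $G$ is said to induce a $k$-periodic Grover walk if $U^k=I_{2m}$ and $U^j\neq I_{2m}$ for every integer $j$ with $1\le j<k$.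
   Formalization: The case r = s = 1 is excluded: K_{1,1} has two arcs that U merely swaps, so U^2 = I and it induces a 2-periodic, not a 4-periodic, Grover walk; the equivalence is stated for K_{r,s} with (r,s) ≠ (1,1). *)

(* Defs.v *)
From mathcomp Require Import all_boot all_order all_algebra.

Set Implicit Arguments.
Unset Strict Implicit.
Unset Printing Implicit Defensive.

Import GRing.Theory Num.Theory.
Local Open Scope ring_scope.

Record sgraph := SGraph {
  vertex :> finType;
  adj : rel vertex;
  adj_sym : symmetric adj;
  adj_irrefl : irreflexive adj
}.

(* The graph with no vertices is not connected. *)
Definition gconnected (G : sgraph) : Prop :=
  (0 < #|G|)%N /\ forall u v : G, connect (@adj G) u v.

Definition giso (G H : sgraph) : Prop :=
  exists f : G -> H, bijective f /\ forall u v : G, adj (f u) (f v) = adj u v.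

Definition deg (G : sgraph) (v : G) : nat := #|[set w | adj v w]|.

Definition Kadj (r s : nat) : rel ('I_r + 'I_s)%type := fun x y =>
  match x, y with
  | inl _, inr _ | inr _, inl _ => true
  | _, _ => false
  end.

Lemma Kadj_sym (r s : nat) : symmetric (@Kadj r s).
Proof. by case=> [?|?] [?|?]. Qed.

Lemma Kadj_irrefl (r s : nat) : irreflexive (@Kadj r s).
Proof. by case. Qed.

Definition complete_bipartite (r s : nat) : sgraph :=
  SGraph (@Kadj_sym r s) (@Kadj_irrefl r s).

Definition symarc (G : sgraph) : finType := {p : G * G | adj p.1 p.2}.

Definition arc_o (G : sgraph) (e : symarc G) : G := (val e).1.
Definition arc_t (G : sgraph) (e : symarc G) : G := (val e).2.

Lemma arc_inv_subproof (G : sgraph) (e : symarc G) :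
  adj (arc_t e, arc_o e).1 (arc_t e, arc_o e).2.
Proof. by rewrite adj_sym; exact: (valP e). Qed.

Definition arc_inv (G : sgraph) (e : symarc G) : symarc G :=
  exist _ (arc_t e, arc_o e) (arc_inv_subproof e).

Definition grover_coef (R : numFieldType) (G : sgraph) (e f : symarc G) : R :=
  if f == arc_inv e then 2%:R / (deg (arc_t f))%:R - 1
  else if arc_t f == arc_o e then 2%:R / (deg (arc_t f))%:R
  else 0.

(* Matrices have ordinal indices, so the arcs are numbered by [enum_val];
   the size #|symarc G| is twice the number of edges. *)
Definition grover (R : numFieldType) (G : sgraph) : 'M[R]_#|symarc G| :=
  \matrix_(i, j) grover_coef R (enum_val i) (enum_val j).

(* The single edge K_{1,1} has period 2: its walk just swaps the two arcs.
   Every other complete bipartite graph with nonempty parts has period 4. *)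
Definition grover_periodic (R : numFieldType) (G : sgraph) (k : nat) : Prop :=
  [/\ (0 < k)%N, grover R G ^+ k = 1%:M
    & forall j : nat, (1 <= j < k)%N -> grover R G ^+ j <> 1%:M].

(* Main.v *)
(* U is orthogonal, so U^4 = 1 iff U^2 = U^-2 is symmetric.  The entry of U^2
   at the arcs ((a,b), (c,d)) is supported on d ~ a, hence its symmetry says,
   for a <> c and b <> d, that d ~ a iff b ~ c.  Thus the ends of a walk of
   length 3 are adjacent and there is no triangle, so in a connected graph the
   two ends of an edge have complementary independent neighborhoods, completely
   joined to each other.  Conversely, in K_{r,s} both entries agree because the
   degree only depends on the side.  Finally U^2 = 1 iff every vertex has at
   most one neighbor, which singles out K_{1,1}. *)

Require Import Defs.
From mathcomp Require Import all_boot all_order all_algebra.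
From mathcomp Require Import ring.

Import GRing.Theory Num.Theory.
Local Open Scope ring_scope.

(** * Orthogonality of [U] and the entries of its square *)

Section GroverMatrix.

Set Implicit Arguments.
Unset Strict Implicit.

Variables (R : numFieldType) (G : sgraph).
Implicit Types (a b c d u v : G) (e f g : symarc G).

Local Notation U := (grover R G).
Local Notation arc e := (enum_rank e).

Lemma deg_neq0 a b : adj a b -> (deg a)%:R != 0 :> R.
Proof.
by move=> ab; rewrite pnatr_eq0 -lt0n; apply/card_gt0P; exists b; rewrite inE.
Qed.

Lemma sum_symarc (F : G * G -> R) :
  \sum_(i < #|symarc G|) F (val (enum_val i)) = \sum_(p | adj p.1 p.2) F p.
Proof.
rewrite -(big_enum_val (fun f : symarc G => F (val f))) /=.
by rewrite (big_sub (fun p : G * G => adj p.1 p.2)).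
Qed.

Lemma sum_neighbor_eq (F : G -> R) a b : adj a b ->
  \sum_(x | adj a x) F x * (x == b)%:R = F b.
Proof.
move=> ab; rewrite (bigD1 b) //= eqxx mulr1 big1 ?addr0 // => x /andP[_ /negPf->].
exact: mulr0.
Qed.

(** Since [f] is the inverse of [e] exactly when both ends match, the three cases merge into one
    product that sums can handle without case analysis. *)
Lemma grover_coefE e f :
  grover_coef R e f = (arc_t f == arc_o e)%:R *
    (2%:R / (deg (arc_o e))%:R - (arc_o f == arc_t e)%:R).
Proof.
rewrite /grover_coef.
have -> : (f == arc_inv e) = (arc_o f == arc_t e) && (arc_t f == arc_o e).
  by rewrite -val_eqE -pair_eqE.
have [->|_] := eqVneq (arc_t f) (arc_o e); last by rewrite andbF mul0r.
by rewrite andbT mul1r; case: eqVneq => _; rewrite ?subr0.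
Qed.

(** Rows at arcs with different origins have disjoint supports. The rows at arcs leaving [a] form,
    up to indexing, the reflection 2/deg(a) J - I, which is symmetric and squares to 1. *)
Lemma grover_mul_tr : U *m U^T = 1%:M.
Proof.
apply/matrixP => i j; rewrite !mxE.
under eq_bigr do rewrite !mxE !grover_coefE.
set e := enum_val i; set g := enum_val j.
have -> : (i == j) = (e == g) by rewrite (inj_eq enum_val_inj).
rewrite (sum_symarc (fun p => (p.2 == arc_o e)%:R *
   (2%:R / (deg (arc_o e))%:R - (p.1 == arc_t e)%:R) * ((p.2 == arc_o g)%:R *
   (2%:R / (deg (arc_o g))%:R - (p.1 == arc_t g)%:R)))).
move: e g => [[a b] /= ab] [[c d] /= cd].
rewrite -val_eqE /arc_o /arc_t /= -pair_eqE /=.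
(* Only arcs ending at [a] contribute, so the sum runs over the neighbors [x] of [a]. *)
transitivity (\sum_(x | adj a x) (a == c)%:R *
    ((2%:R / (deg a)%:R - (x == b)%:R) * (2%:R / (deg c)%:R - (x == d)%:R)) : R).
  rewrite big_mkcond -(pair_bigA _ (fun x y => if adj x y then (y == a)%:R *
   (2%:R / (deg a)%:R - (x == b)%:R) * ((y == c)%:R *
   (2%:R / (deg c)%:R - (x == d)%:R)) else 0)) /= [RHS]big_mkcond.
  apply: eq_bigr => x _; rewrite (bigD1 a) //= big1 => [|y /negPf->]; last first.
    by rewrite !mul0r if_same.
  by rewrite addr0 eqxx mul1r adj_sym mulrCA.
rewrite -big_distrr /=; have [ac|_] := eqVneq a c; last by rewrite mul0r.
rewrite -ac in cd *; rewrite mul1r; set k := 2%:R / _.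
rewrite (eq_bigr (fun x => k * k - k * (x == b)%:R - k * (x == d)%:R +
   (x == d)%:R * (x == b)%:R)); last first.
  by move=> x _; move: (x == b)%:R (x == d)%:R => p q; ring.
rewrite !big_split /= !sumrN !sum_neighbor_eq //.
have -> : \sum_(x | adj a x) k * k = (deg a)%:R * (k * k).
  by rewrite sumr_const mulr_natl /deg cardsE.
have : (deg a)%:R * k = 2%:R by rewrite mulrC divfK ?(deg_neq0 ab).
by move=> dk; rewrite [_ * (k * k)]mulrA dk; ring.
Qed.

(** The only possible intermediate arc goes from [arc_t g] to [arc_o e]. *)
Lemma grover_sqrE e g : (U ^+ 2) (arc e) (arc g) =
  (adj (arc_t g) (arc_o e))%:R *
    ((2%:R / (deg (arc_o e))%:R - (arc_t g == arc_t e)%:R) *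
     (2%:R / (deg (arc_t g))%:R - (arc_o g == arc_o e)%:R)).
Proof.
rewrite expr2 mxE.
under eq_bigr do rewrite !mxE !enum_rankK !grover_coefE.
rewrite (sum_symarc (fun p => (p.2 == arc_o e)%:R *
   (2%:R / (deg (arc_o e))%:R - (p.1 == arc_t e)%:R) * ((arc_t g == p.1)%:R *
   (2%:R / (deg p.1)%:R - (arc_o g == p.2)%:R)))).
rewrite big_mkcond (bigD1 (arc_t g, arc_o e)) //= big1 => [|[x y]].
  by rewrite addr0 !eqxx !mul1r; case: adj; rewrite ?mul0r ?mul1r.
rewrite -pair_eqE /= negb_and => /orP[] /negPf xy; case: ifP => // _.
  by rewrite [arc_t g == x]eq_sym xy mul0r mulr0.
by rewrite xy !mul0r.
Qed.

Lemma grover_exp4P : U ^+ 4 = 1%:M <-> (U ^+ 2)^T = U ^+ 2.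
Proof.
have trU2 : U ^+ 2 *m (U ^+ 2)^T = 1%:M.
  rewrite expr2 trmx_mul mulmxA -[U * U *m _]mulmxA grover_mul_tr mulmx1.
  exact: grover_mul_tr.
have -> : U ^+ 4 = U ^+ 2 *m U ^+ 2 by rewrite (exprD U 2 2).
split=> [U4|sym]; last by rewrite -[X in _ *m X]sym.
by rewrite -[LHS]mul1mx -U4 -mulmxA trU2 mulmx1.
Qed.

(** * Symmetry of [U ^+ 2] and complete bipartitions *)

(** This is a complete bipartition; an empty side is allowed and then there are no edges. *)
Definition bipartition (side : G -> bool) :=
  forall u v, adj u v = (side u != side v).

Lemma bipartition_deg side a b :
  bipartition side -> side a = side b -> deg a = deg b.
Proof. by move=> sG ab; apply: eq_card => v; rewrite !inE !sG ab. Qed.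

Definition to_arc {a b} (ab : adj a b) : symarc G := exist _ (a, b) ab.

Lemma grover_sqr_tr_bipartition side :
  bipartition side -> (U ^+ 2)^T = U ^+ 2.
Proof.
move=> sG; apply/matrixP => i j; rewrite mxE -(enum_valK i) -(enum_valK j).
move: (enum_val i) (enum_val j) => [[a b] /= ab] [[c d] /= cd].
rewrite !grover_sqrE /arc_o /arc_t /= [b == d]eq_sym [a == c]eq_sym.
have := ab; have := cd; rewrite !sG => scd sab.
have -> : (side b != side c) = (side d != side a).
  by move: scd sab; do 4!case: (side _).
case: eqP => [|/eqP sda]; first by rewrite !mul0r.
(* When [d] is adjacent to [a], the vertices [a] and [c] share a side, and so do [b] and [d]. *)
rewrite !mul1r (bipartition_deg (a := a) (b := c) sG) //; last first.
  by move: scd sab sda; do 4!case: (side _).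
rewrite (bipartition_deg (a := b) (b := d) sG) //.
by move: scd sab sda; do 4!case: (side _).
Qed.

(** Both Kronecker terms vanish, so each of the two mirrored entries is an adjacency indicator times
    a nonzero factor. *)
Lemma grover_sqr_tr_adj a b c d : (U ^+ 2)^T = U ^+ 2 ->
  adj a b -> adj c d -> a != c -> b != d -> adj d a = adj b c.
Proof.
move=> sym ab cd ac bd.
have /matrixP/(_ (arc (to_arc cd)) (arc (to_arc ab))) := sym.
rewrite mxE !grover_sqrE /arc_o /arc_t /= [d == b]eq_sym [c == a]eq_sym.
rewrite (negPf ac) (negPf bd) !subr0.
have nz u v : adj u v -> 2%:R / (deg u)%:R != 0 :> R.
  by move=> uv; rewrite mulf_neq0 ?invr_eq0 ?(deg_neq0 uv) ?pnatr_eq0.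
have na := nz _ _ ab; have nc := nz _ _ cd.
have nb : 2%:R / (deg b)%:R != 0 :> R by apply: (nz _ a); rewrite adj_sym.
have nd : 2%:R / (deg d)%:R != 0 :> R by apply: (nz _ c); rewrite adj_sym.
case: (adj d a); case: (adj b c) => //; rewrite ?mul0r ?mul1r => /eqP.
  by rewrite mulf_eq0 (negPf na) (negPf nd).
by rewrite eq_sym mulf_eq0 (negPf nb) (negPf nc).
Qed.

Lemma sqr_tr_path3 a b c d : (U ^+ 2)^T = U ^+ 2 ->
  adj a b -> adj b c -> adj c d -> adj a d.
Proof.
move=> sym ab bc cd.
have [<-//|bd] := eqVneq b d.
have [->//|ac] := eqVneq a c.
(* The arcs compared are [(b, a)] and [(d, c)]. *)
by rewrite -(grover_sqr_tr_adj (a := b) (d := c)) // adj_sym.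
Qed.

Lemma sqr_tr_triangle_free a b c : (U ^+ 2)^T = U ^+ 2 ->
  adj a b -> adj a c -> ~~ adj b c.
Proof.
move=> sym ab ac.
have neq u v : adj u v -> u != v.
  by apply: contraTneq => ->; rewrite adj_irrefl.
(* The arcs [(a, b)] and [(c, a)] equate [adj b c] with the loop [adj a a]. *)
by rewrite -(grover_sqr_tr_adj (a := a) (d := a)) ?adj_irrefl ?neq // adj_sym.
Qed.

Lemma grover_sqr_trP : gconnected G ->
  (U ^+ 2)^T = U ^+ 2 <-> exists side, bipartition side.
Proof.
move=> [_ conn]; split=> [sym|[side]]; last exact: grover_sqr_tr_bipartition.
have [[x y] /= xy|noadj] := pickP (fun p : G * G => adj p.1 p.2); last first.
  by exists (fun=> false) => u v; apply: (noadj (u, v)).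
have path3 a b c d := @sqr_tr_path3 a b c d sym.
have tri a b c := @sqr_tr_triangle_free a b c sym.
have yx : adj y x by rewrite adj_sym.
(* By [path3] the neighbors of [x] or [y] form a set closed under adjacency, so connectedness makes
   it everything. *)
have cover v : adj x v || adj y v.
  have clo : closed (@adj G) [pred v | adj x v || adj y v].
    apply: intro_closed => [|u w uw]; first exact/sym_connect_sym/adj_sym.
    rewrite !inE.
    case/orP=> [xu|yu]; first by rewrite (path3 y x u w) ?orbT.
    by rewrite (path3 x y u w).
  by have := closed_connect clo (conn y v); rewrite !inE xy => <-.
exists (adj x) => u v.
have [xu|/negPf xu] := boolP (adj x u); have [xv|/negPf xv] := boolP (adj x v).
- exact/negbTE/(tri x).
- have := cover v; rewrite xv => yv.
  by apply: (path3 u x y v); rewrite // adj_sym.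
- have := cover u; rewrite xu => yu.
  by rewrite adj_sym; apply: (path3 v x y u); rewrite // adj_sym.
- have := cover u; have := cover v; rewrite xu xv /= => yv yu.
  exact/negbTE/(tri y).
Qed.

(* If a ~ b ~ c with a <> c, the entry of U^2 at ((a,b),(c,b)) forces
   deg a = 2, and then the diagonal entry at (a,b) vanishes. *)
Lemma grover_sqr1P :
  U ^+ 2 = 1%:M <-> forall a b c, adj a b -> adj c b -> a = c.
Proof.
split=> [U2 a b c ab cb|adj_fun].
  apply/eqP/negPn/negP => ac.
  have ba : adj b a by rewrite adj_sym.
  have := grover_sqrE (to_arc ab) (to_arc cb).
  have := grover_sqrE (to_arc ab) (to_arc ab).
  rewrite U2 !mxE !(inj_eq enum_rank_inj) -!val_eqE /arc_o /arc_t /= !eqxx ba.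
  rewrite -pair_eqE /= (negPf ac) [c == a]eq_sym (negPf ac) subr0 !mul1r.
  move=> diag /esym/eqP; rewrite !mulf_eq0 invr_eq0 (negPf (deg_neq0 ba)).
  rewrite pnatr_eq0 /= orbF => /eqP da; move/eqP: diag.
  by rewrite da mul0r oner_eq0.
apply/matrixP => i j; rewrite -(enum_valK i) -(enum_valK j).
move: (enum_val i) (enum_val j) => [[a b] /= ab] [[c d] /= cd].
rewrite grover_sqrE mxE (inj_eq enum_rank_inj) -val_eqE /arc_o /arc_t /=.
have [da|da] := boolP (adj d a); last first.
  rewrite mul0r -pair_eqE /=; case: (eqVneq b d) => [bd|_]; last by rewrite andbF.
  by rewrite -bd adj_sym ab in da.
have deg1 u v : adj u v -> deg u = 1%N.
  move=> uv; rewrite /deg -(cards1 v); apply: eq_card => w; rewrite !inE.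
  apply/idP/eqP => [uw|->//].
  by apply: (adj_fun _ u); rewrite adj_sym.
(* Unique neighbors make the two arcs equal and all degrees involved 1, so the entry is (2 -
   1)^2. *)
have db : d = b by apply: (adj_fun _ a) => //; rewrite adj_sym.
rewrite db in cd da *; have ca : c = a by apply: (adj_fun _ b).
rewrite ca (deg1 _ _ ab) (deg1 _ _ da) !eqxx.
by rewrite divr1 -(natrB _ (isT : (1 <= 2)%N)) !mul1r.
Qed.

Lemma grover_periodic4P :
  grover_periodic R G 4 <-> U ^+ 4 = 1%:M /\ U ^+ 2 <> 1%:M.
Proof.
split=> [[_ U4 low]|[U4 U2]]; first by split; last exact: low.
split=> // -[|[|[|[|//]]]] // _ UE; apply: U2 => //.
  by rewrite expr1 in UE; rewrite UE expr2; apply: mulmx1.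
(* Period 3 is excluded too: [U ^+ 3] and [U ^+ 4] both trivial would give [U ^+ 2] = [U ^+ 6] =
   1. *)
have -> : U ^+ 2 = U ^+ 4 *m U ^+ 2 by rewrite U4 mul1mx.
have -> : U ^+ 4 *m U ^+ 2 = U ^+ 3 *m U ^+ 3.
  by rewrite -[LHS](exprD U 4 2) -[RHS](exprD U 3 3).
by rewrite UE mulmx1.
Qed.

End GroverMatrix.

(** * Bipartitions as isomorphisms with complete bipartite graphs *)

Section CompleteBipartite.

Set Implicit Arguments.
Unset Strict Implicit.

Variable G : sgraph.

Lemma bipartition_giso (side : G -> bool) (x y : G) :
  bipartition side -> side x -> ~~ side y ->
  giso G (complete_bipartite #|[set v | side v]| #|[set v | ~~ side v]|).
Proof.
move=> sG sx sy.
have xS : x \in [set v | side v] by rewrite inE.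
have yS : y \in [set v | ~~ side v] by rewrite inE.
(* The witnesses [x] and [y] only supply the default of [enum_rank_in], never reached since each
   branch ranks a vertex of its own side. *)
pose f v : complete_bipartite _ _ := if side v
  then inl (enum_rank_in xS v) else inr (enum_rank_in yS v).
pose g (w : complete_bipartite #|[set v | side v]| #|[set v | ~~ side v]|) :
  G := match w with inl i => enum_val i | inr j => enum_val j end.
exists f; split=> [|u v]; last by rewrite sG /f; do 2!case: ifP.
exists g => [v|[i|j]]; rewrite /f /g.
- by case: ifP => sv; rewrite enum_rankK_in // inE sv.
- by have := enum_valP i; rewrite inE enum_valK_in => ->.
- by have := enum_valP j; rewrite inE enum_valK_in => /negPf ->.
Qed.

Lemma giso_bipartition (r s : nat)
    (f : G -> complete_bipartite r s) :
  (forall u v, adj (f u) (f v) = adj u v) ->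
  bipartition (fun v => if f v is inl _ then true else false).
Proof. by move=> fadj u v; rewrite -fadj /=; case: (f u) (f v) => [?|?] [?|?]. Qed.

(** Two vertices on one side share a neighbor on the other, so uniqueness forces both sides to be
    singletons. *)
Lemma giso_complete_bipartite_unique_neighbor (r s : nat) :
  (0 < r)%N -> (0 < s)%N -> giso G (complete_bipartite r s) ->
  (forall a b c : G, adj a b -> adj c b -> a = c) <-> (r, s) = (1, 1)%N.
Proof.
move=> r0 s0 [f [[g gK fK] fadj]].
have gadj u v : adj (g u) (g v) = adj u v by rewrite -fadj !fK.
split=> [uniq|[r1 s1] a b c].
  suff [r1 s1] : (r <= 1)%N /\ (s <= 1)%N.
    by congr pair; apply/eqP; rewrite eqn_leq ?r1 ?s1.
  split; rewrite leqNgt; apply/negP => lt1.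
    have := uniq (g (inl (Ordinal r0))) (g (inr (Ordinal s0)))
      (g (inl (Ordinal lt1))).
    by rewrite !gadj => /(_ isT isT) /(can_inj fK).
  have := uniq (g (inr (Ordinal s0))) (g (inl (Ordinal r0)))
    (g (inr (Ordinal lt1))).
  by rewrite !gadj => /(_ isT isT) /(can_inj fK).
rewrite -!fadj => ab cb; apply: (can_inj gK).
move: ab cb; subst r s.
by case: (f a) (f b) (f c) => [i|i] [j|j] [k|k] //= _ _; rewrite (ord1 i) (ord1 k).
Qed.

End CompleteBipartite.

Theorem theorem4p1 (R : numFieldType) (G : sgraph) (hG : gconnected G) :
  grover_periodic R G 4 <->
  exists r s : nat,
    [/\ (0 < r)%N, (0 < s)%N, (r, s) <> (1, 1)%N
      & giso G (complete_bipartite r s)].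
Proof.
apply: iff_trans (grover_periodic4P R G) _; split=> [[]|[r [s [r0 s0 rs iso]]]].
  move=> /grover_exp4P /(grover_sqr_trP _ hG) [side sG] U2.
  (* Without edges [U ^+ 2] would be trivially 1; an edge makes both sides nonempty. *)
  have [[x y] /= xy|noadj] := pickP (fun p : G * G => adj p.1 p.2); last first.
    by case: U2; apply/grover_sqr1P => a b c; rewrite (noadj (a, b)).
  have [u [v [su sv]]] : exists u v, side u /\ ~~ side v.
    move: xy; rewrite sG; case sx: (side x); case sy: (side y) => // _.
      by exists x, y; rewrite sx sy.
    by exists y, x; rewrite sx sy.
  have iso := bipartition_giso sG su sv.
  have r0 : (0 < #|[set v | side v]|)%N.
    by apply/card_gt0P; exists u; rewrite inE.
  have s0 : (0 < #|[set v | ~~ side v]|)%N.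
    by apply/card_gt0P; exists v; rewrite inE.
  exists #|[set v | side v]|, #|[set v | ~~ side v]|; split=> // rs.
  apply: U2; apply/grover_sqr1P.
  exact/(giso_complete_bipartite_unique_neighbor r0 s0 iso).
split.
  have [f [_ fadj]] := iso; apply/grover_exp4P/(grover_sqr_trP _ hG).
  by exists (fun v => if f v is inl _ then true else false); apply: giso_bipartition.
by move=> /grover_sqr1P/(giso_complete_bipartite_unique_neighbor r0 s0 iso).
Qed.
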